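(* Let $P\subset\mathbb{R}^2$ be a convex polygon, $G$ a non-trivial symmetry group of $P$, and $\mathcal{S}=\{S_1,\dots,S_m\}$ a contractible $G$-symmetric $P$-polygonal system with attractor $K$. Let $A,B$ be two distinct vertices of $P$ and let $L=[A,B]$ be the line segment joining them. Let $\mathcal{Z}=\{S_1',\dots,S_k'\}$ be a family of maps from the augmented system $\widetilde{\mathcal{S}}$ such that $\widetilde L=\bigcup_{i=1}^k S_i'(L)$ is a polygonal line connecting $A$ and $B$. Then the attractor $K_{\mathcal{Z}}$ of $\mathcal{Z}$ is a subcontinuum of $K$. If, moreover, for some $j\in\{1,\dots,m\}$ the set $\widetilde L\cap P_j$, where $P_j=S_j(P)$, contains more than one of the segments $S'_i(L)$, then $K_{\mathcal{Z}}$ is a dendrite.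
   Context: Let $P$ be a convex polygon in $\mathbb{R}^2$ with vertex set $V_P=\{A_1,\dots,A_{n_P}\}$. A finite system $\mathcal{S}=\{S_1,\dots,S_m\}$ of contracting similarities of $\mathbb{R}^2$ (put $I=\{1,\dots,m\}$) is a contractible $P$-polygonal system if: (D1) for every $k\in I$, $P_k=S_k(P)\subset P$; (D2) for $i\ne j$ in $I$, $P_i\cap P_j$ is either empty or a single point that is a common vertex of $P_i$ and $P_j$; (D3) for every $A_k\in V_P$ there are $S_i\in\mathcal{S}$ and $A_l\in V_P$ with $S_i(A_l)=A_k$; (D4) $\widetilde P=\bigcup_{i=1}^m P_i$ is contractible. Let $G$ be a non-trivial group of isometries of the plane mapping $P$ onto itself. A contractible $P$-polygonal system $\mathcal{S}$ is called $G$-symmetric if for every $g\in G$ and $S_i\in\mathcal{S}$ there are $g'\in G$ and $S_j\in\mathcal{S}$ with $g\circ S_i=S_j\circ g'$. The augmented system for $\mathcal{S}$ is $\widetilde{\mathcal{S}}=\{S_i\circ g: S_i\in\mathcal{S},\ g\in G\}$. The attractor of a finite system of contractions $\{T_1,\dots,T_r\}$ of $\mathbb{R}^2$ is the unique nonempty compact set $C$ with $C=\bigcup_{i=1}^r T_i(C)$. It is known that the attractor of a contractible $P$-polygonal system is a dendrite. A continuum is a nonempty compact connected metric space; a dendrite is a locally connected continuum containing no simple closed curve. That $\widetilde L$ is a polygonal line connecting $A$ and $B$ means that, after numbering the maps suitably, there are points $A=z_0,z_1,\dots,z_k=B$ such that $S_i'(L)=[z_{i-1},z_i]$ for $i=1,\dots,k$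 (so $S_i'(\{A,B\})=\{z_{i-1},z_i\}$). *)

(* Defs.v *)
From mathcomp Require Import all_boot all_order all_algebra all_fingroup.
From mathcomp Require Import all_classical all_reals all_analysis.

Set Implicit Arguments.
Unset Strict Implicit.
Unset Printing Implicit Defensive.

Import Order.TTheory GRing.Theory Num.Theory.
Import numFieldNormedType.Exports.

Local Open Scope classical_set_scope.
Local Open Scope ring_scope.

(* The library norm on 'rV_n is the sup norm: it induces the usual topology
   but not the Euclidean metric, whence edist. *)
Notation plane R := ('rV[R]_2).

Definition edist (R : realType) (x y : plane R) : R :=
  Num.sqrt (\sum_(i < 2) (x ord0 i - y ord0 i) ^+ 2).

Definition plane_isometry (R : realType) (f : plane R -> plane R) : Prop :=
  forall x y, edist (f x) (f y) = edist x y.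

Definition contracting_similarity (R : realType)
    (f : plane R -> plane R) : Prop :=
  exists r : R, 0 < r < 1 /\ forall x y, edist (f x) (f y) = r * edist x y.

Definition hull (R : realType) (X : set (plane R)) : set (plane R) :=
  smallest (@convex_set R (plane R)) X.

Definition segment (R : realType) (a b : plane R) : set (plane R) :=
  [set (1 - t) *: a + t *: b | t in `[0, 1]].

(* v lists the vertices of the polygon hull (range v): no vertex lies in the
   hull of the others. Together with 3 <= n this makes v injective and the
   polygon non-degenerate. *)
Definition convex_polygon_vertices (R : realType) (n : nat)
    (v : 'I_n -> plane R) : Prop :=
  (3 <= n)%N /\ forall k : 'I_n, ~ hull (v @` [set~ k]) (v k).

(* X, with the subspace topology, is nonempty and deformable within itself to
   one of its points. *)
Definition contractible (R : realType) (T : topologicalType)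
    (X : set T) : Prop :=
  exists (x0 : T) (H : R * T -> T),
    [/\ X x0,
        {within `[0, 1] `*` X, continuous H},
        H @` (`[0, 1] `*` X) `<=` X,
        forall x, X x -> H (0, x) = x
      & forall x, X x -> H (1, x) = x0].

Definition contractible_polygonal_system (R : realType) (n m : nat)
    (v : 'I_n -> plane R) (S : 'I_m -> plane R -> plane R) : Prop :=
  let V := range v in
  let P := hull V in
  [/\ forall k, contracting_similarity (S k),
      forall k, S k @` P `<=` P,
      forall i j, i != j ->
        (S i @` P) `&` (S j @` P) = set0 \/
        exists x, [/\ (S i @` P) `&` (S j @` P) = [set x],
                      (S i @` V) x & (S j @` V) x],
      forall k, exists i l, S i (v l) = v k
    & contractible R (\bigcup_i (S i @` P))].

Definition nontrivial_symmetry_group (R : realType) (P : set (plane R))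
    (G : set (plane R -> plane R)) : Prop :=
  [/\ forall g, G g -> plane_isometry g /\ g @` P = P,
      G id,
      forall g h, G g -> G h -> G (g \o h),
      forall g, G g -> exists h, [/\ G h, h \o g = id & g \o h = id]
    & exists g, G g /\ g <> id].

Definition symmetric_system (R : realType) (m : nat)
    (G : set (plane R -> plane R)) (S : 'I_m -> plane R -> plane R) : Prop :=
  forall g i, G g -> exists g' j, G g' /\ g \o S i = S j \o g'.

Definition augmented_system (R : realType) (m : nat)
    (G : set (plane R -> plane R)) (S : 'I_m -> plane R -> plane R) :
    set (plane R -> plane R) :=
  [set f | exists i g, G g /\ f = S i \o g].

(* By Hutchinson's theorem a finite system of contractions of the plane has
   exactly one such set. *)
Definition is_attractor (R : realType) (r : nat)
    (F : 'I_r -> plane R -> plane R) (C : set (plane R)) : Prop :=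
  [/\ C !=set0, compact C & C = \bigcup_i (F i @` C)].

Definition continuum (T : topologicalType) (X : set T) : Prop :=
  [/\ X !=set0, compact X & connected X].

(* The subspace X is locally connected: the relatively open sets are the
   U `&` X with U open. *)
Definition locally_connected (T : topologicalType) (X : set T) : Prop :=
  forall x U, X x -> open U -> U x ->
    exists W, [/\ open W, W x, W `&` X `<=` U & connected (W `&` X)].

Definition contains_simple_closed_curve (R : realType) (T : topologicalType)
    (X : set T) : Prop :=
  exists gamma : R -> T,
    [/\ {within `[0, 1], continuous gamma},
        gamma 0 = gamma 1,
        {in `[0, 1[ &, injective gamma}
      & gamma @` `[0, 1] `<=` X].

Definition dendrite (R : realType) (T : topologicalType) (X : set T) : Prop :=
  [/\ continuum X, locally_connected X
    & ~ contains_simple_closed_curve R X].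

(* The permutation s is the renumbering of the maps. *)
Definition polygonal_line (R : realType) (k : nat) (A B : plane R)
    (F : 'I_k -> plane R -> plane R) : Prop :=
  exists (s : 'S_k) (z : nat -> plane R),
    [/\ z 0%N = A, z k = B
      & forall i : 'I_k, F (s i) @` segment A B = segment (z i) (z i.+1)].

(* Main.v *)
(* The sets of KZ saturated under distance < eps pull back under the maps to sets
   saturated under distance < eps / r, so by induction on the scale only KZ
   itself is such a set: KZ is connected because consecutive images of KZ share
   the points z_i.  A connected attractor is a finite union of arbitrarily small
   connected pieces, hence locally connected.

   KZ is contained in K, and K contains no simple closed curve.  For this, the
   contractibility of the union of the P_i is used through one consequence: a
   real function on it that is continuous modulo 1 lifts to a continuous one.
   Applied to a bump at a common point p of P_i and P_j, supported in P_i, this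
   shows that p separates any subfamily of pieces containing P_i and P_j.  Hence a
   simple closed curve in K lies in a single S_i(K); rescaling by S_i^-1 and
   iterating, its diameter is 0. *)

Require Import Defs.
From mathcomp Require Import all_boot all_order all_algebra all_fingroup.
From mathcomp Require Import all_classical all_reals all_analysis.
From mathcomp Require Import ring lra.
Import Order.TTheory GRing.Theory Num.Theory.
Import numFieldNormedType.Exports.
Local Open Scope classical_set_scope.
Local Open Scope ring_scope.

Set Implicit Arguments.
Unset Strict Implicit.
Unset Printing Implicit Defensive.

(* MathComp-Analysis also has an edist, which would shadow this one. *)
Local Notation edist := Defs.edist.

(** * Euclidean distance and iterated contractions *)

Lemma edist_ge0 (R : realType) (x y : plane R) : 0 <= edist x y.
Proof. exact: sqrtr_ge0. Qed.

Lemma edistxx (R : realType) (x : plane R) : edist x x = 0.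
Proof.
by rewrite /edist big1 ?sqrtr0// => i _; rewrite subrr expr0n.
Qed.

Lemma norm_le_edist (R : realType) (x y : plane R) : `|x - y| <= edist x y.
Proof.
rewrite [leLHS]/Num.Def.normr /= mx_normrE; apply/bigmax_leP; split=> [|[i j] _ /=].
  exact: edist_ge0.
rewrite !mxE (ord1 i) /edist -sqrtr_sqr; apply: ler_wsqrtr.
rewrite (bigD1 j)//= lerDl; apply: sumr_ge0 => l _; exact: sqr_ge0.
Qed.

Lemma edist_le_norm (R : realType) (x y : plane R) : edist x y <= 2 * `|x - y|.
Proof.
have coord i : (x ord0 i - y ord0 i) ^+ 2 <= `|x - y| ^+ 2.
  rewrite -real_normK ?num_real// ler_sqr ?nnegrE// [leRHS]/Num.Def.normr /= mx_normrE.
  by apply/bigmax_geP; right; exists (ord0, i) => //=; rewrite !mxE.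
have n0 : 0 <= `|x - y| by [].
rewrite -(@ler_pXn2r _ 2)// ?nnegrE ?edist_ge0 ?mulr_ge0//.
rewrite sqr_sqrtr; last by apply: sumr_ge0 => i _; exact: sqr_ge0.
rewrite !big_ord_recl big_ord0; set i := lift _ _.
have := coord ord0; have := coord i; nra.
Qed.

Lemma edist_eq0 (R : realType) (x y : plane R) : edist x y = 0 -> x = y.
Proof.
move=> xy; apply/eqP; rewrite -subr_eq0 -normr_le0 -xy.
exact: norm_le_edist.
Qed.

Lemma edist_gt0 (R : realType) (x y : plane R) : x <> y -> 0 < edist x y.
Proof.
by move=> xy; rewrite lt_neqAle edist_ge0 andbT eq_sym; apply/eqP => /edist_eq0.
Qed.

Lemma edist_segment (R : realType) (a b : plane R) (t u : R) :
  edist ((1 - t) *: a + t *: b) ((1 - u) *: a + u *: b) = `|t - u| * edist a b.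
Proof.
rewrite /edist -[`|t - u|]sqrtr_sqr -sqrtrM ?sqr_ge0//; congr Num.sqrt.
by rewrite mulr_sumr; apply: eq_bigr => i _; rewrite !mxE; ring.
Qed.

Lemma nbhs_edistP (R : realType) (x : plane R) (U : set (plane R)) :
  nbhs x U <-> exists2 e, 0 < e & forall y, edist x y < e -> U y.
Proof.
split=> [/nbhs_ballP[e e0 eU]|[e e0 eU]].
  exists e => // y xy.
  by apply: eU; rewrite -ball_normE /=; exact: le_lt_trans (norm_le_edist x y) xy.
apply/nbhs_ballP; exists (e / 2) => /=; first exact: divr_gt0.
move=> y; rewrite -ball_normE /= => xy; apply: eU.
by apply: le_lt_trans (edist_le_norm x y) _; rewrite mulrC -ltr_pdivlMr.
Qed.

Lemma compact_edist_bounded (R : realType) (X : set (plane R)) : compact X ->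
  exists2 D, 0 < D & forall x y, X x -> X y -> edist x y < D.
Proof.
move=> /compact_bounded /ex_strict_bound_gt0 [M M0 XM].
exists (4 * M) => [|x y Xx Xy]; first by rewrite mulr_gt0.
apply: le_lt_trans (edist_le_norm x y) _.
have := ler_normB x y; have := XM _ Xx; have := XM _ Xy; rewrite /=.
lra.
Qed.

(** An upper bound rather than an equality, so that one ratio serves all maps of a system. *)
Definition contracts (R : realType) (r : R) (f : plane R -> plane R) :=
  forall x y, edist (f x) (f y) <= r * edist x y.

Lemma contracts_continuous (R : realType) (r : R) (f : plane R -> plane R) :
  0 < r -> contracts r f -> continuous f.
Proof.
move=> r0 fr x U /nbhs_edistP[e e0 eU]; apply/nbhs_edistP.
exists (e / r) => [|y xy]; first exact: divr_gt0.
by apply: eU; apply: le_lt_trans (fr x y) _; rewrite mulrC -ltr_pdivlMr.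
Qed.

Lemma common_ratio (R : realType) (k : nat) (F : 'I_k -> plane R -> plane R) :
  (forall i, contracting_similarity (F i)) ->
  exists2 r : R, 0 < r < 1 & forall i, contracts r (F i).
Proof.
(* The initial value [2^-1] keeps the ratio positive when there are no maps. *)
move=> /choice[r rF]; exists (\big[Num.max/2^-1]_i r i).
  apply/andP; split; first by apply: lt_le_trans (bigmax_ge_id _ _ _ _); lra.
  apply/bigmax_ltP; split=> [|i _]; first by lra.
  by have [/andP[]] := rF i.
move=> i x y; have [_ ->] := rF i; apply: ler_wpM2r; first exact: edist_ge0.
exact: le_bigmax.
Qed.

Lemma similarity_inj (R : realType) (f : plane R -> plane R) :
  contracting_similarity f -> injective f.
Proof.
move=> [r [/andP[r0 _] fr]] x y fxy; apply: edist_eq0.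
have := fr x y; rewrite fxy edistxx => /esym/eqP.
by rewrite mulf_eq0 (gt_eqF r0)/= => /eqP.
Qed.

Lemma expr_lt_eps (R : realType) (r D e : R) : 0 < r < 1 -> 0 < e ->
  exists N : nat, r ^+ N * D < e.
Proof.
move=> /andP[r0 r1] e0.
have /(@cvgrPdist_lt _ R^o) /(_ (e / (`|D| + 1))) : (fun n => r ^+ n) @ \oo --> (0 : R).
  by apply: cvg_expr; rewrite gtr0_norm.
have D0 : 0 < `|D| + 1 by rewrite ltr_wpDl.
move=> /(_ (divr_gt0 e0 D0)) [N _ /(_ N (leqnn N))] /=.
rewrite sub0r normrN ger0_norm ?exprn_ge0 ?ltW// ltr_pdivlMr// => H.
exists N; apply: le_lt_trans H; apply: ler_wpM2l; first by rewrite exprn_ge0 ?ltW.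
by have := ler_norm D; lra.
Qed.

Lemma closed_approx (R : realType) (Y : set (plane R)) (x : plane R) :
  closed Y -> (forall e, 0 < e -> exists2 y, Y y & edist x y < e) -> Y x.
Proof.
move=> cY H; apply: cY => U /nbhs_edistP[e e0 eU].
by have [y Yy xy] := H e e0; exists y; split=> //; exact: eU.
Qed.

(** Unfolding a point of [X] through [N] maps and replacing the innermost point by one of [Y] gives
    a point of [Y] within [r ^+ N * D]. All inclusions between attractors and other sets below come
    from this. *)
Lemma subinvariant_sub (R : realType) (k : nat) (F : 'I_k -> plane R -> plane R)
    (X Y : set (plane R)) (D : R) :
  (forall i, contracting_similarity (F i)) ->
  X `<=` \bigcup_i (F i @` X) -> (forall i, F i @` Y `<=` Y) ->
  closed Y -> Y !=set0 ->
  (forall x y, X x -> Y y -> edist x y < D) -> X `<=` Y.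
Proof.
move=> simF XF FY cY [y0 Yy0] XYD.
have [r r01 rF] := common_ratio simF; have /andP[r0 _] := r01.
have H N : forall x, X x -> exists2 y, Y y & edist x y <= r ^+ N * D.
  elim: N => [x Xx|N IH x Xx].
    by exists y0 => //; rewrite expr0 mul1r; apply/ltW/XYD.
  have [i _ [x' Xx' <-]] := XF x Xx; have [y Yy xy] := IH _ Xx'.
  exists (F i y); first by apply: FY; exists y.
  apply: le_trans (rF i _ _) _; rewrite exprS -mulrA.
  by apply: ler_wpM2l => //; exact: ltW.
move=> x Xx; apply: closed_approx => // e e0.
have [N Ne] := expr_lt_eps D r01 e0.
by have [y Yy xy] := H N x Xx; exists y => //; exact: le_lt_trans xy Ne.
Qed.

(** * Hulls of finite sets *)

Lemma convex_set_comb (R : realType) (D : set (plane R)) (x y : plane R) (t : R) :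
  convex_set D -> D x -> D y -> 0 <= t <= 1 -> D (t *: x + (1 - t) *: y).
Proof.
move=> cD Dx Dy /andP[t0 t1].
by have := cD x y (Itv01 t0 t1); rewrite !inE; apply.
Qed.

(** The weights need not sum to 1, so that the induction can drop the last one without rescaling. *)
Lemma convex_set_weighted (R : realType) (D : set (plane R)) (n : nat)
    (v : 'I_n -> plane R) (l : 'I_n -> R) :
  convex_set D -> D !=set0 -> (forall i, D (v i)) -> (forall i, 0 <= l i) ->
  exists2 y, D y & \sum_i l i *: v i = (\sum_i l i) *: y.
Proof.
move=> cD [y0 Dy0]; elim: n v l => [|n IH] v l Dv l0.
  by exists y0 => //; rewrite !big_ord0 scale0r.
rewrite !big_ord_recr /=.
have [y Dy ->] := IH (fun i => v (widen_ord (leqnSn n) i))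
  (fun i => l (widen_ord (leqnSn n) i)) (fun i => Dv _) (fun i => l0 _).
set s := \sum_i _; set a := l ord_max.
have s0 : 0 <= s by apply: sumr_ge0.
have a0 : 0 <= a by exact: l0.
(* With total weight 0 both weights vanish and any point of [D] serves. *)
have [sa0|sa0] := eqVneq (s + a) 0.
  have -> : s = 0 by lra.
  have -> : a = 0 by lra.
  by exists y => //; rewrite !scale0r !addr0 scale0r.
have sa_gt0 : 0 < s + a by rewrite lt_neqAle eq_sym sa0 addr_ge0.
exists ((s / (s + a)) *: y + (1 - s / (s + a)) *: v ord_max).
  apply: convex_set_comb => //.
  by rewrite divr_ge0 ?addr_ge0//= ler_pdivrMr// mul1r lerDl.
rewrite scalerDr !scalerA; congr (_ *: _ + _ *: _).
  by rewrite mulrCA divff// mulr1.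
by rewrite mulrBr mulr1 mulrCA divff// mulr1 addrAC subrr add0r.
Qed.

Definition simplex (R : realType) (n : nat) : set 'rV[R]_n :=
  [set l | (forall i, 0 <= l ord0 i) /\ \sum_i l ord0 i = 1].

Lemma compact_simplex (R : realType) (n : nat) : compact (@simplex R n).
Proof.
apply: (@subclosed_compact _ _ [set l : 'rV[R]_n | forall i, `[0, 1]%classic (l ord0 i)]).
- rewrite (_ : @simplex R n = (\bigcap_i [set l : 'rV[R]_n | 0 <= l ord0 i]) `&`
    [set l | \sum_i l ord0 i = 1]); last first.
    by apply/seteqP; split=> [l [l0 l1]|l [l0 l1]]; split=> // i; [move=> _|]; exact: l0.
  apply: closedI.
    apply: closed_bigI => i _.
    apply: (@closed_comp _ _ (fun l : 'rV[R]_n => l ord0 i) [set x | 0 <= x]).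
      move=> l _; exact: coord_continuous.
    exact: (@closed_ge R 0).
  apply: (@closed_comp _ _ (fun l : 'rV[R]_n => \sum_i l ord0 i) [set x | x = 1]).
    move=> l _; apply: continuous_big => [|i _]; first exact: add_continuous.
    exact: coord_continuous.
  exact: (@closed_eq R 1).
- apply: (@rV_compact _ _ (fun=> `[0 : R, 1]%classic)) => _; exact: segment_compact.
- move=> l [l0 l1] i /=; rewrite in_itv/= l0 /= -l1 (bigD1 i)//= lerDl.
  by apply: sumr_ge0.
Qed.

(** The image of the simplex is convex and contains the vertices; conversely, a convex set
    containing the vertices contains all their weighted averages. Compactness of the polygon follows
    from this form. *)
Lemma hull_simplex (R : realType) (n : nat) (v : 'I_n -> plane R) :
  range v !=set0 ->
  hull (range v) = (fun l : 'rV[R]_n => \sum_i l ord0 i *: v i) @` @simplex R n.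
Proof.
move=> [x0 [i0 _ _]]; apply/seteqP; split.
  apply: smallest_sub.
    move=> x y t; rewrite !inE => -[l [l0 l1] <-] [l' [l'0 l'1] <-].
    exists (t%:num *: l + (1 - t%:num) *: l'); last first.
      rewrite /conv /= !scaler_sumr -big_split /=; apply: eq_bigr => i _.
      by rewrite !mxE scalerDl !scalerA.
    split=> [i|].
      by rewrite !mxE addr_ge0 ?mulr_ge0// subr_ge0.
    under eq_bigr do rewrite !mxE.
    by rewrite big_split /= -!mulr_sumr l1 l'1; ring.
  move=> _ [i _ <-]; exists (\row_j (i == j)%:R).
    split=> [j|]; first by rewrite mxE.
    rewrite (bigD1 i)//= mxE eqxx big1 ?addr0// => j ji.
    by rewrite mxE eq_sym (negbTE ji).
  rewrite (bigD1 i)//= mxE eqxx scale1r big1 ?addr0// => j ji.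
  by rewrite mxE eq_sym (negbTE ji) scale0r.
move=> _ [l [l0 l1] <-] D /= [cD vD].
have [|i|//|y Dy ->] := @convex_set_weighted _ D _ v (fun i => l ord0 i) cD.
- by exists (v i0); apply: vD; exists i0.
- by apply: vD; exists i.
by rewrite l1 scale1r.
Qed.

Lemma compact_hull (R : realType) (n : nat) (v : 'I_n -> plane R) :
  range v !=set0 -> compact (hull (range v)).
Proof.
move=> v0; rewrite hull_simplex//; apply: continuous_compact.
  apply: continuous_subspaceT; apply: continuous_big => [|i _ l].
    exact: add_continuous.
  exact: (@cvgZr_tmp _ _ _ (nbhs l) _ _ _ _ (@coord_continuous R 1 n ord0 i l)).
exact: compact_simplex.
Qed.

Lemma connected_segment (R : realType) (a b : plane R) : connected (segment a b).
Proof.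
apply: connected_continuous_connected; first exact: segment_connected.
apply: continuous_subspaceT => t; apply: cvgD.
  by apply: cvgZr_tmp; apply: cvgB; [exact: cvg_cst|exact: cvg_id].
by apply: cvgZr_tmp; exact: cvg_id.
Qed.

(** A convex set is the union of the segments issuing from one of its points. *)
Lemma connected_hull (R : realType) (X : set (plane R)) : connected (hull X).
Proof.
have [[a ha]|] := pselect (hull X !=set0); last first.
  by move=> /nonemptyPn ->; exact: connected0.
have -> : hull X = \bigcup_(x in hull X) segment a x.
  apply/seteqP; split=> [x hx|x [y hy [t t01 <-]]].
    exists x => //; exists 1; first by rewrite /= in_itv/= ler01 lexx.
    by rewrite subrr scale0r add0r scale1r.
  move: t01; rewrite /= in_itv/= => t01 D /= [cD XD].
  have Da : D a by exact: ha.
  have Dy : D y by exact: hy.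
  by have := @convex_set_comb R D a y (1 - t) cD Da Dy; rewrite subKr; apply; lra.
apply: bigcup_connected => [|x _]; last exact: connected_segment.
exists a => x _; exists 0; first by rewrite /= in_itv/= ler01 lexx.
by rewrite subr0 scale0r addr0 scale1r.
Qed.

(** * Lifting functions that are continuous modulo 1 *)

(** Both [Q] and its negation are relatively open in [A]. *)
Lemma connected_locally_constant (T : topologicalType) (A : set T) (Q : T -> Prop) :
  connected A -> (exists2 a, A a & Q a) ->
  (forall t, A t -> \forall s \near t, A s -> (Q s <-> Q t)) ->
  forall t, A t -> Q t.
Proof.
move=> cA [a Aa Qa] locQ.
suff <- : A `&` Q = A by move=> t [].
apply: cA; first by exists a.
- exists (interior [set s | A s -> Q s]); first exact: open_interior.
  apply/seteqP; split=> t [At Qt]; split=> //.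
    by apply: filterS (locQ t At) => s H As; apply/H.
  by have := @nbhs_singleton _ t _ Qt; apply.
- exists (~` interior [set s | A s -> ~ Q s]); first exact/open_closedC/open_interior.
  apply/seteqP; split=> t [At Qt]; split=> //.
    by move=> H; have := @nbhs_singleton _ t _ H; apply.
  apply: contrapT => nQt; apply: Qt.
  by apply: filterS (locQ t At) => s H As /(H As).
Qed.

(** Continuity of the map induced by [f] from [X] to the circle R/Z; [f] itself may jump by
    integers. *)
Definition continuous_mod_int (R : realType) (T : topologicalType) (X : set T)
    (f : T -> R) :=
  forall x, X x -> forall e, 0 < e -> \forall y \near x,
    X y -> exists n : int, `|f y - f x - n%:~R| < e.

(** The induced circle map factors through the covering of R/Z by the real line. *)
Definition liftable (R : realType) (T : topologicalType) (X : set T)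
    (f : T -> R) :=
  exists g : T -> R, {within X, continuous g} /\
    forall x, X x -> exists n : int, g x = f x + n%:~R.

(** A lift [g] of [f] selects a lift of [h]: the integer to add to [h x] is the one nearest to
    [g x - h x]. *)
Lemma liftable_close (R : realType) (T : topologicalType) (X : set T)
    (f h : T -> R) :
  continuous_mod_int X h ->
  (forall x, X x -> exists n : int, `|h x - f x - n%:~R| < 4^-1) ->
  liftable X f -> liftable X h.
Proof.
move=> ch fh [g [cg gf]].
have /choice[n nP] : forall x, exists n : int, X x -> `|g x - h x - n%:~R| < 4^-1.
  move=> x; have [Xx|] := pselect (X x); last by exists 0.
  have [n nP] := fh _ Xx; have [k gk] := gf _ Xx.
  exists (k - n) => _; rewrite gk intrB -normrN.
  by rewrite [X in `|X|](_ : _ = h x - f x - n%:~R)//; ring.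
exists (fun x => h x + (n x)%:~R); split; last by move=> x Xx; exists (n x).
apply/subspace_continuousP => x Xx; apply/cvgrPdist_lt => e e0.
move/subspace_continuousP/(_ x Xx)/cvgrPdist_lt : cg => cg.
have d0 : 0 < Num.min e 8^-1 by rewrite lt_min e0/=; lra.
have {}cg := cg _ d0; have {}ch := ch x Xx _ d0.
rewrite near_withinE in cg; rewrite near_withinE.
near=> y => Xy.
have gxy : `|g x - g y| < Num.min e 8^-1 by have : X y := Xy; near: y.
have [k hxy] : exists k : int, `|h y - h x - k%:~R| < Num.min e 8^-1.
  by have : X y := Xy; near: y.
have := nP _ Xx; have := nP _ Xy.
move: gxy hxy; rewrite !lt_min !ltr_norml => /andP[_ gxy] /andP[hxye hxy] ny nx.
suff -> : h x + (n x)%:~R - (h y + (n y)%:~R) = - (h y - h x - k%:~R).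
  by lra.
(* This integer is made of two errors below 1/4 and two below 1/8, so its absolute value is less
   than 1. *)
suff : n x - n y - k = 0.
  by move=> /(congr1 (fun z : int => z%:~R : R)); rewrite !intrB; lra.
apply/eqP; rewrite -normr_le0 -ltzD1 add0r -(ltr_int R) intr_norm !intrB ltr_norml.
lra.
Unshelve. all: by end_near. Qed.

Lemma homotopy_continuous_mod_int (R : realType) (T : topologicalType) (X : set T)
    (H : R * T -> T) (f : T -> R) (t : R) :
  {within `[0, 1] `*` X, continuous H} -> H @` (`[0, 1] `*` X) `<=` X ->
  continuous_mod_int X f -> `[0, 1]%classic t ->
  forall x, X x -> forall e, 0 < e -> \forall y \near x & s \near t,
    X y -> `[0, 1]%classic s ->
    exists n : int, `|f (H (s, y)) - f (H (t, x)) - n%:~R| < e.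
Proof.
move=> /subspace_continuousP cH HX cf t01 x Xx e e0.
have Htx : X (H (t, x)) by apply: HX; exists (t, x).
have [[U V] /= [Ut Vx] UV] : nbhs (t, x) (fun p : R * T => (`[0, 1] `*` X) p ->
    X (H p) -> exists n : int, `|f (H p) - f (H (t, x)) - n%:~R| < e).
  exact: cH (t, x) (conj t01 Xx) _ (cf _ Htx e e0).
exists (V, U) => //= -[y s] /= [Vy Us] Xy s01.
by apply: (UV (s, y)) => //; apply: HX; exists (s, y).
Qed.

(* The set of times t at which f (H (t, -)) is liftable is clopen in [0, 1]
   and contains 1, where this function is constant. *)
Lemma contractible_liftable (R : realType) (T : topologicalType) (X : set T)
    (f : T -> R) :
  compact X -> contractible R X -> continuous_mod_int X f -> liftable X f.
Proof.
move=> kX [x0 [H [Xx0 cH HX H0 H1]]] cf.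
pose F t x := f (H (t, x)).
have cF (t : R) : `[0, 1]%classic t -> continuous_mod_int X (F t).
  move=> t01 x Xx e e0.
  have := homotopy_continuous_mod_int cH HX cf t01 Xx e0.
  move=> [[V U] /= [Vx Ut] VU]; apply: filterS Vx => y Vy Xy.
  apply: (VU (y, t)) => //; split=> //=; exact: nbhs_singleton.
have close (t : R) : `[0, 1]%classic t -> \forall s \near t, `[0, 1]%classic s ->
    forall x, X x -> exists n : int, `|F s x - F t x - n%:~R| < 4^-1.
  move=> t01.
  pose P s x := `[0, 1]%classic s -> exists n : int, `|F s x - F t x - n%:~R| < 4^-1.
  suff : \forall s \near t, X `<=` P s by apply: filterS => s sP s01 x Xx; exact: sP.
  move/compact_near_coveringP/near_covering_withinP : kX => kX.
  apply: (kX R (nbhs t) P) => x Xx.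
  (* [F s y] and [F t y] are both compared with [F t x]; two errors of 1/8 make the required 1/4. *)
  have e0 : (0 : R) < 8^-1 by lra.
  have := homotopy_continuous_mod_int cH HX cf t01 Xx e0.
  move=> [[V U] /= [Vx Ut] VU]; exists (V, U) => //= -[y s] /= [Vy Us] Xy s01.
  have [n1] := VU (y, s) (conj Vy Us) Xy s01.
  have [n2] := VU (y, t) (conj Vy (nbhs_singleton Ut)) Xy t01.
  rewrite /= -/(F t x) -/(F s y) -/(F t y) !ltr_norml => h1 h2.
  by exists (n1 - n2); rewrite intrB ltr_norml; lra.
have L0 : liftable X (F 0).
  apply: (@connected_locally_constant R `[0, 1]%classic (fun t => liftable X (F t))).
  - exact: segment_connected.
  - exists 1; first by rewrite /= in_itv/= ler01 lexx.
    exists (fun=> f x0); split; first exact/continuous_subspaceT/cst_continuous.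
    by move=> x Xx; exists 0; rewrite /F H1// addr0.
  - move=> t t01; apply: filterS (close t t01) => s st s01.
    split; apply: liftable_close; try exact: cF; last exact: st.
    move=> x Xx; have [n nP] := st s01 x Xx; exists (- n); rewrite -normrN intrN.
    by rewrite [X in `|X|](_ : _ = F s x - F t x - n%:~R)//; ring.
  - by rewrite /= in_itv/= ler01 lexx.
have [g [cg gP]] := L0; exists g; split=> // x Xx.
by have [n ->] := gP x Xx; exists n; rewrite /F H0.
Qed.

(** * Cut points of a contractible union *)

Lemma int_valued_constant (R : realType) (T : topologicalType) (A : set T)
    (h : T -> R) :
  connected A -> {within A, continuous h} ->
  (forall x, A x -> exists n : int, h x = n%:~R) ->
  forall x y, A x -> A y -> h x = h y.
Proof.
move=> cA ch hZ x y Ax Ay.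
apply: (connected_locally_constant (Q := fun z => h x = h z) cA) => // [|z Az].
  by exists x.
move/subspace_continuousP/(_ z Az)/cvgrPdist_lt : ch => /(_ 1 ltr01).
rewrite near_withinE => {}ch; apply: filterS ch => w zw Aw.
have hzw : `|h z - h w| < 1 := zw Aw.
suff hwz : h w = h z by rewrite hwz.
have [n hn] := hZ _ Az; have [k hk] := hZ _ Aw; move: hzw; rewrite hn hk => nk.
congr (_%:~R); apply/eqP; rewrite -subr_eq0 -normr_le0 -ltzD1 add0r.
by rewrite -(ltr_int R) intr_norm intrB distrC.
Qed.

Lemma near_finite_closed (T : topologicalType) (I : finType) (P : I -> set T) (x : T) :
  (forall i, closed (P i)) -> \forall y \near x, forall i, P i y -> P i x.
Proof.
move=> cP; apply: filter_forall => i.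
have [Px|nPx] := pselect (P i x); first by apply: nearW.
have : nbhs x (~` P i) by apply: open_nbhs_nbhs; split=> //; exact: closed_openC.
by apply: filterS => y nPy /nPy.
Qed.

(** Provides the radius of a bump at [p] that vanishes at the finitely many other points where
    pieces meet. *)
Lemma separating_radius (R : realType) (m : nat) (P : 'I_m -> set (plane R))
    (p : plane R) :
  (forall j, exists x, P j `<=` [set x]) ->
  exists2 e : R, 0 < e & forall j x, P j x -> x <> p -> e <= `|x - p|.
Proof.
(* An index whose point is [p] itself gets the value 1, which keeps the minimum positive. *)
move=> /choice[q qP]; pose d j := if q j == p then 1 else `|q j - p|.
exists (\big[Num.min/1]_j d j).
  apply/bigmin_gtP; split=> // j _; rewrite /d; case: eqVneq => // qp.
  by rewrite normr_gt0 subr_eq0.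
move=> j x /qP -> qp; apply: (@le_trans _ _ (d j)); first exact: bigmin_le_cond.
by rewrite /d; case: eqP.
Qed.

Definition bump (R : realType) (p : plane R) (e : R) (x : plane R) : R :=
  Num.max 0 (1 - `|x - p| / e).

Lemma bump_continuous (R : realType) (p : plane R) (e : R) : continuous (bump p e).
Proof.
move=> x; apply: (@continuous_max R (plane R) (fun=> 0) (fun x => 1 - `|x - p| / e)).
  exact: cst_continuous.
have nx : `|y - p| @[y --> x] --> `|x - p|.
  exact: (cvg_norm (@cvgB R (plane R) _ (nbhs x) _ id (fun=> p) x p cvg_id (cvg_cst p))).
have me := @cvgMr_tmp R _ (nbhs x) _ (fun y => `|y - p|) _ (e^-1) nx.
exact: (@cvgB R R^o _ (nbhs x) _ (fun=> 1) (fun y => `|y - p| / e) _ _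
  (cvg_cst _) (me _)).
Qed.

Lemma bump_center (R : realType) (p : plane R) (e : R) : bump p e p = 1.
Proof. by rewrite /bump subrr normr0 mul0r subr0; apply/max_idPr. Qed.

Lemma bump_far (R : realType) (p x : plane R) (e : R) :
  0 < e -> e <= `|x - p| -> bump p e x = 0.
Proof.
by move=> e0 xp; apply/max_idPl; rewrite subr_le0 ler_pdivlMr// mul1r.
Qed.

(* Cutting the union of the pieces at p0 inside P i0: on P i0 take a bump at
   p0, elsewhere 0. Modulo 1 this is continuous, hence liftable, and the lift
   differs from the given function on each P i by a constant c i. *)
Lemma contractible_cut (R : realType) (m : nat) (P : 'I_m -> set (plane R))
    (i0 j0 : 'I_m) (p0 : plane R) :
  (forall i, compact (P i)) -> (forall i, connected (P i)) ->
  (forall i j, i != j -> exists x, P i `&` P j `<=` [set x]) ->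
  contractible R (\bigcup_i P i) ->
  j0 != i0 -> P i0 p0 -> P j0 p0 ->
  exists c : 'I_m -> R, c j0 = c i0 + 1 /\
    forall a b x, c a != c i0 + 1 -> c b = c i0 + 1 -> P a x -> P b x -> x = p0.
Proof.
move=> kP cP Pij contrP j0i0 P0 Pj0.
have clP i : closed (P i) by apply: compact_closed => //; exact: norm_hausdorff.
(* Only for [j] other than [i0] is the intersection known to be at most one point, hence the empty
   set at [i0]. *)
pose I0 j := if j == i0 then set0 else P i0 `&` P j.
have [j|e e0 eP] := @separating_radius R m I0 p0.
  rewrite /I0; case: eqVneq => ji0; first by exists 0.
  by apply: Pij; rewrite eq_sym.
have bP j x : j != i0 -> P i0 x -> P j x -> x <> p0 -> bump p0 e x = 0.
  move=> ji0 Px Pjx xp; apply: bump_far => //; apply: (eP j) => //.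
  by rewrite /I0 (negbTE ji0).
(* Where [P i0] meets another piece the bump is 0 or 1, so dropping to 0 there is invisible modulo
   1. *)
have bZ j x : j != i0 -> P i0 x -> P j x -> exists n : int, bump p0 e x = n%:~R.
  move=> ji0 Px Pjx; have [->|/eqP xp] := eqVneq x p0.
    by exists 1; rewrite bump_center.
  by exists 0; rewrite (bP j).
pose f x := if pselect (P i0 x) then bump p0 e x else 0.
have fin x : P i0 x -> f x = bump p0 e x by rewrite /f; case: pselect.
have fout x : ~ P i0 x -> f x = 0 by rewrite /f; case: pselect.
have cf : continuous_mod_int (\bigcup_i P i) f.
  move=> x _ d d0; have nP := @near_finite_closed _ _ P x clP.
  have := @bump_continuous R p0 e x; move/cvgrPdist_lt/(_ d d0) => nb.
  near=> y => -[j _ Pjy].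
  have Pxy : forall i, P i y -> P i x by near: y.
  have [Py|nPy] := pselect (P i0 y).
    exists 0; rewrite !fin ?subr0; [|exact: Pxy|by []].
    by rewrite distrC; near: y.
  have [Px|nPx] := pselect (P i0 x); last first.
    by exists 0; rewrite !fout// !subr0 normr0.
  (* Now [x] is in [P i0] and [y] is not. The piece of [y] also contains [x], so [f x] is an integer
     while [f y] is 0. *)
  have ji0 : j != i0 by apply: contra_notN nPy => /eqP <-.
  have [n bn] := bZ j x ji0 Px (Pxy _ Pjy).
  by exists (- n); rewrite fout// fin// bn intrN opprK sub0r addNr normr0.
have kU : compact (\bigcup_i P i).
  have -> : \bigcup_i P i = \big[setU/set0]_i P i.
    rewrite -bigcup_seq; apply: eq_bigcupl; split=> i // _.
    by rewrite /= mem_index_enum.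
  by apply: bigsetU_compact.
have [g [cg gf]] := contractible_liftable kU contrP cf.
(* A continuous representative, modulo 1, of [f] on [P i]; [f] itself jumps on [P j0] if points of
   [P j0] outside [P i0] accumulate at [p0]. *)
pose fi i x : R := if i == i0 then bump p0 e x else 0.
have ffi i x : P i x -> exists n : int, f x = fi i x + n%:~R.
  move=> Px; rewrite /fi; case: eqVneq => [ii0|ii0].
    by exists 0; rewrite fin ?addr0// -ii0.
  have [P0x|nP0x] := pselect (P i0 x); last by exists 0; rewrite fout// addr0.
  by have [n bn] := bZ i x ii0 P0x Px; exists n; rewrite fin// add0r.
have cfi i : continuous (fi i).
  rewrite /fi; case: eqP => _; [exact: bump_continuous|exact: cst_continuous].
(* On the connected set [P i] the difference [g - fi i] is continuous with integer values. *)
have /choice[c cE] : forall i, exists c, forall x, P i x -> g x = fi i x + c.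
  move=> i; have [[y Py]|/nonemptyPn Pe] := pselect (P i !=set0); last first.
    by exists 0 => x; rewrite Pe.
  exists (g y - fi i y) => x Px.
  suff : g x - fi i x = g y - fi i y by lra.
  apply: (@int_valued_constant R _ (P i) (fun z => g z - fi i z)) => //.
    apply/subspace_continuousP => z Pz; apply: cvgB.
      have PU : P i `<=` \bigcup_i P i by move=> w Pw; exists i.
      by move: z Pz; apply/subspace_continuousP; exact: continuous_subspaceW cg.
    by apply: cvg_within_filter; exact: cfi.
  move=> z Pz; have [|n gn] := gf z; first by exists i.
  by have [k fk] := ffi i z Pz; exists (k + n); rewrite gn fk intrD; ring.
have cE0 x : P i0 x -> g x = bump p0 e x + c i0.
  by move=> Px; rewrite (cE i0)// /fi eqxx.
have cEn i x : i != i0 -> P i x -> g x = c i.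
  by move=> ii0 Px; rewrite (cE i)// /fi (negbTE ii0) add0r.
(* At [p0] the lift is [c j0] when computed in [P j0] and [1 + c i0] when computed in [P i0]. *)
exists c; split; first by rewrite -(cEn j0 p0)// cE0// bump_center addrC.
move=> a b x ca cb Pa Pb.
have bi0 : b != i0 by apply: contra_eq_neq cb => ->; lra.
have gx := cEn b x bi0 Pb; have [ai0|ai0] := eqVneq a i0; last first.
  by move: ca; rewrite -(cEn a x)// gx cb eqxx.
(* Away from [p0] the bump vanishes at [x], so [g x] would equal both [c i0] and [c i0 + 1]. *)
rewrite ai0 in Pa; apply: contrapT => xp.
have := cE0 x Pa; rewrite (bP b x)// gx cb; lra.
Unshelve. all: by end_near. Qed.

(** The constants of [contractible_cut] come from the whole union, and their level sets are then
    restricted to the subfamily [T]; [i0] and [j0] fall on different sides, so both parts are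
    proper. *)
Lemma contractible_split (R : realType) (m : nat) (P : 'I_m -> set (plane R)) :
  (forall i, compact (P i)) -> (forall i, connected (P i)) ->
  (forall i j, i != j -> exists x, P i `&` P j `<=` [set x]) ->
  contractible R (\bigcup_i P i) ->
  forall T : {set 'I_m}, (1 < #|T|)%N ->
  exists (T1 T2 : {set 'I_m}) (p : plane R),
    [/\ T1 \proper T, T2 \proper T, T = T1 :|: T2 &
        forall a b x, a \in T1 -> b \in T2 -> P a x -> P b x -> x = p].
Proof.
move=> kP cP Pij contrP T T1.
have [i0 i0T] : exists i0, i0 \in T by apply/card_gt0P; exact: ltn_trans T1.
have [[j0 [j0T j0i0 [p0 [P0 Pj0]]]]|nj] :=
    pselect (exists j, [/\ j \in T, j != i0 & P i0 `&` P j !=set0]).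
  have [c [cj0 cP0]] := contractible_cut kP cP Pij contrP j0i0 P0 Pj0.
  exists [set i in T | c i != c i0 + 1], [set i in T | c i == c i0 + 1], p0; split.
  - apply/properP; split; first by apply/fintype.subsetP => i; rewrite inE => /andP[].
    by exists j0; rewrite // inE cj0 eqxx andbF.
  - apply/properP; split; first by apply/fintype.subsetP => i; rewrite inE => /andP[].
    by exists i0; rewrite // inE negb_and; apply/orP; right; apply/eqP; lra.
  - by apply/setP => i; rewrite !inE -andb_orr orNb andbT.
  - move=> a b x; rewrite !inE => /andP[_ ca] /andP[_ /eqP cb].
    exact: cP0.
(* Here [i0] meets no other piece of [T], so the cut point is arbitrary. *)
exists [set i0]%SET, (T :\ i0)%SET, 0; split.
- rewrite properEcard finset.sub1set i0T/= cards1//.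
- by apply: properD1.
- by rewrite finset.setD1K.
- move=> a b x; rewrite !inE => /eqP -> /andP[bi0 bT] Pa Pb.
  by exfalso; apply: nj; exists b; split=> //; exists x.
Qed.

(** * Simple closed curves *)

Lemma connected_closed_disjoint (R : realType) (T : topologicalType) (A : set R)
    (g : R -> T) (C1 C2 : set T) :
  connected A -> {within A, continuous g} -> closed C1 -> closed C2 ->
  (forall t, A t -> C1 (g t) \/ C2 (g t)) ->
  (forall t, A t -> C1 (g t) -> C2 (g t) -> False) ->
  (forall t, A t -> C1 (g t)) \/ (forall t, A t -> C2 (g t)).
Proof.
move=> cA cg cC1 cC2 gC gI.
have avoid C t : closed C -> A t -> ~ C (g t) -> \forall s \near t, A s -> ~ C (g s).
  move=> cC At nC; move/subspace_continuousP/(_ t At) : cg => /(_ (~` C)).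
  by apply; apply: open_nbhs_nbhs; split=> //; exact: closed_openC.
have [[t0 At0]|/nonemptyPn A0] := pselect (A !=set0); last first.
  by left=> t; rewrite A0.
have sat C C' : closed C -> closed C' -> (forall t, A t -> C (g t) \/ C' (g t)) ->
    (forall t, A t -> C (g t) -> C' (g t) -> False) -> C (g t0) ->
    forall t, A t -> C (g t).
  move=> cC cC' CC' CI Ct0.
  apply: (connected_locally_constant (Q := fun t => C (g t)) cA) => [|t At].
    by exists t0.
  have [Ct|nCt] := pselect (C (g t)).
    apply: filterS (avoid C' t cC' At (CI t At Ct)) => s nC' As; split=> // _.
    by have [//|/(nC' As)] := CC' s As.
  by apply: filterS (avoid C t cC At nCt) => s nCs As; split=> // /(nCs As).
have [C1t|C2t] := gC t0 At0; [left; exact: (sat C1 C2)|right].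
apply: (sat C2 C1) => // t At; first by have [] := gC t At; [right|left].
by move=> ? ?; exact: (gI t).
Qed.

Definition simple_closed_curve (R : realType) (T : topologicalType)
    (g : R -> T) : Prop :=
  [/\ {within `[0, 1], continuous g}, g 0 = g 1 & {in `[0, 1[ &, injective g}].

(* Removing one point from a simple closed curve leaves a connected set. *)
Lemma simple_closed_curve_cut (R : realType) (T : topologicalType)
    (g : R -> T) (C1 C2 : set T) (p : T) :
  simple_closed_curve g -> closed C1 -> closed C2 ->
  g @` `[0, 1] `<=` C1 `|` C2 -> C1 `&` C2 `<=` [set p] ->
  g @` `[0, 1] `<=` C1 \/ g @` `[0, 1] `<=` C2.
Proof.
move=> [cg g01 ig] cC1 cC2 gC CI.
have i0 : `[0, 1]%classic (0 : R) by rewrite /= in_itv/= lexx ler01.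
have i1 : `[0, 1]%classic (1 : R) by rewrite /= in_itv/= lexx ler01.
have gC' t : `[0, 1]%classic t -> C1 (g t) \/ C2 (g t).
  by move=> t01; apply: gC; exists t.
(* A parameter of [p], sought below 1 because injectivity holds on [[0, 1[] only. *)
have [[t0 [t01 t1 C1t C2t]]|nI] :=
    pselect (exists t0, [/\ 0 <= t0, t0 < 1, C1 (g t0) & C2 (g t0)]); last first.
  have [t t01|H|H] := connected_closed_disjoint
    (@segment_connected R 0 1) cg cC1 cC2 gC'.
  - move: t01; rewrite /= in_itv/= => /andP[t0 t1] C1t C2t.
    have [t1'|t1'] := eqVneq t 1.
      by apply: nI; exists 0; rewrite ltr01 g01 -t1'.
    by apply: nI; exists t; rewrite lt_neqAle t1' t1.
  - by left=> _ [t t01 <-]; exact: H.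
  - by right=> _ [t t01 <-]; exact: H.
(* The implication excludes the one coincidence left by injectivity: [t = 1] with [t0 = 0]. *)
have gp t : 0 <= t <= 1 -> t != t0 -> ((t == 1) ==> (t0 != 0)) ->
    C1 (g t) -> C2 (g t) -> False.
  move=> /andP[t0' t1'] tt0 tt1 C1t' C2t'.
  have e : g t = g t0 by rewrite (CI (g t))// (CI (g t0)).
  have [t1e|t1e] := eqVneq t 1.
    move: tt1; rewrite t1e eqxx /= => /eqP; apply; apply/esym.
    by apply: ig; rewrite ?in_itv/= ?lexx ?ltr01 ?t01// g01 -t1e.
  move/eqP : tt0; apply; apply: ig => //; rewrite in_itv/= ?t01// t0'/=.
  by rewrite lt_neqAle t1e t1'.
have itv_case (i : interval R) : (forall t, t \in i -> 0 <= t <= 1) ->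
    (forall t, t \in i -> (t != t0) && ((t == 1) ==> (t0 != 0))) ->
    (forall t, t \in i -> C1 (g t)) \/ (forall t, t \in i -> C2 (g t)).
  move=> i01 iP.
  apply: (@connected_closed_disjoint R T [set` i] g) => //.
  - exact/connected_intervalP/interval_is_interval.
  - by apply: continuous_subspaceW cg => t /i01; rewrite /= in_itv.
  - by move=> t /i01 t01'; apply: gC'; rewrite /= in_itv.
  - by move=> t ti; have /andP[] := iP t ti; apply: gp; exact: i01.
have [t00|t00] := eqVneq t0 0.
  have fin C : C (g t0) -> (forall t, t \in `]0, 1[ -> C (g t)) -> g @` `[0, 1] `<=` C.
    move=> Ct0 H _ [t + <-]; rewrite /= in_itv/= => /andP[t0' t1'].
    have [->|tn0] := eqVneq t 0; first by rewrite -t00.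
    have [->|tn1] := eqVneq t 1; first by rewrite -g01 -t00.
    by apply: H; rewrite in_itv/= !lt_neqAle eq_sym tn0 t0' tn1 t1'.
  have [t|t|H|H] := itv_case `]0, 1[.
  - by rewrite in_itv/=; lra.
  - rewrite in_itv/= t00 => /andP[t0' t1'].
    by rewrite (gt_eqF t0') (lt_eqF t1').
  - by left; exact: fin.
  - by right; exact: fin.
have fin C : C (g t0) -> (forall t, t \in `[0, t0[ -> C (g t)) ->
    (forall t, t \in `]t0, 1] -> C (g t)) -> g @` `[0, 1] `<=` C.
  move=> Ct0 H1 H2 _ [t + <-]; rewrite /= in_itv/= => /andP[t0' t1'].
  have [tt0|tt0|->//] := ltgtP t t0.
    by apply: H1; rewrite in_itv/= t0' tt0.
  by apply: H2; rewrite in_itv/= tt0.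
have l0 : (0 : R) \in `[0, t0[ by rewrite in_itv/= lexx lt_neqAle eq_sym t00.
have r1 : (1 : R) \in `]t0, 1] by rewrite in_itv/= lexx t1.
(* When [t0] is not 0, the two arcs left by removing it share the point [g 0 = g 1], which forces
   them into the same set. *)
have gp0 : C1 (g 0) -> C2 (g 0) -> False.
  by apply: gp; rewrite ?lexx ?ler01// 1?eq_sym// t00 implybT.
have HL := itv_case `[0, t0[; have HR := itv_case `]t0, 1].
case: HL => [t|t|HL|HL].
- by rewrite in_itv/=; lra.
- by rewrite in_itv/= => /andP[t0' t1']; rewrite (lt_eqF t1') /= t00 implybT.
all: case: HR => [t|t|HR|HR].
all: try by rewrite in_itv/=; lra.
all: try by rewrite in_itv/= => /andP[t0' t1']; rewrite (gt_eqF t0') /= t00 implybT.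
- by left; exact: fin.
- by exfalso; apply: gp0; [exact: HL|rewrite g01; exact: HR].
- by exfalso; apply: gp0; [rewrite g01; exact: HR|exact: HL].
- by right; exact: fin.
Qed.

(** A splitting of the family writes its union as two closed sets meeting at most in [p]; the curve
    lies in one of them, which uses fewer pieces. *)
Lemma simple_closed_curve_in_piece (R : realType) (T : topologicalType) (m : nat)
    (C : 'I_m -> set T) (g : R -> T) :
  simple_closed_curve g -> (forall i, closed (C i)) ->
  (forall U : {set 'I_m}, (1 < #|U|)%N ->
    exists (U1 U2 : {set 'I_m}) (p : T),
      [/\ U1 \proper U, U2 \proper U, U = U1 :|: U2 &
        forall a b x, a \in U1 -> b \in U2 -> C a x -> C b x -> x = p]) ->
  g @` `[0, 1] `<=` \bigcup_i C i -> exists i, g @` `[0, 1] `<=` C i.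
Proof.
move=> scc clC split gC.
suff : forall N (U : {set 'I_m}), (#|U| <= N)%N ->
    g @` `[0, 1] `<=` \bigcup_(i in [set` U]) C i -> exists i, g @` `[0, 1] `<=` C i.
  move=> /(_ _ [set: 'I_m]%SET (leqnn _)); apply=> x /gC [i _ Cx].
  by exists i; rewrite //= inE.
have g0 : (g @` `[0, 1]) (g 0) by exists 0; rewrite //= in_itv/= lexx ler01.
elim=> [U|N IH U UN gU].
  rewrite leqn0 cards_eq0 => /eqP -> /(_ _ g0) [i].
  by rewrite /= inE.
have [U1|] := ltnP 1 #|U|; last first.
  rewrite leq_eqVlt ltnS leqn0 cards_eq0 => /orP[/cards1P[i Ui]|/eqP U0].
    exists i => x /gU [j]; rewrite /= Ui inE => /eqP -> //.
  by have [i] := gU _ g0; rewrite /= U0 inE.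
have [V [W [p [VU WU UVW VWp]]]] := split U U1.
have cl (X : {set 'I_m}) : closed (\bigcup_(i in [set` X]) C i).
  by apply: closed_bigcup => // i _; exact: clC.
have small (X : {set 'I_m}) : X \proper U -> (#|X| <= N)%N.
  by move=> /proper_card XU; rewrite -ltnS; exact: leq_trans XU UN.
have [|x [[a aV Ca] [b bW Cb]]|gV|gW] :=
    simple_closed_curve_cut (p := p) scc (cl V) (cl W).
- move=> x /gU [i]; rewrite /= UVW inE => /orP[iV|iW] Cx.
    by left; exists i.
  by right; exists i.
- exact: (VWp a b).
- exact: (IH V (small _ VU)).
- exact: (IH W (small _ WU)).
Qed.

(** Since [f] multiplies distances by a positive constant, its inverse is continuous and injective
    on the image. *)
Lemma curve_unscale (R : realType) (f : plane R -> plane R) (X : set (plane R))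
    (g : R -> plane R) :
  contracting_similarity f -> simple_closed_curve g ->
  g @` `[0, 1] `<=` f @` X ->
  exists h : R -> plane R, [/\ simple_closed_curve h, h @` `[0, 1] `<=` X &
    forall t, `[0, 1]%classic t -> g t = f (h t)].
Proof.
move=> simf [cg g01 ig] gX.
have /choice[h hP] : forall t, exists y, `[0, 1]%classic t -> X y /\ g t = f y.
  move=> t; have [t01|] := pselect (`[0, 1]%classic t); last by exists 0.
  by have [|y Xy yt] := gX (g t); [exists t|exists y].
have fi := similarity_inj simf; have [r [/andP[r0 _] fr]] := simf.
have [i0 i1] : `[0, 1]%classic (0 : R) /\ `[0, 1]%classic (1 : R).
  by rewrite /= !in_itv/= !lexx ler01.
exists h; split; last by move=> t /hP[].
- split.
  + apply/subspace_continuousP => t t01 U /nbhs_edistP[e e0 eU].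
    have Vg : nbhs (g t) [set y | edist (g t) y < r * e].
      by apply/nbhs_edistP; exists (r * e) => //; exact: mulr_gt0.
    have : nbhs t (fun s => `[0, 1]%classic s -> edist (g t) (g s) < r * e).
      by move/subspace_continuousP/(_ t t01 _ Vg) : cg.
    move=> gt; apply: (@filterS _ (nbhs t) _ _ _ _ gt) => s H s01.
    apply: eU; have := H s01; rewrite (hP t t01).2 (hP s s01).2 fr.
    by rewrite ltr_pM2l.
  + by apply: fi; rewrite -(hP 0 i0).2 -(hP 1 i1).2.
  + move=> s t s01 t01 hst; apply: ig => //.
    have w (u : R) : u \in `[0, 1[ -> `[0, 1]%classic u.
      by rewrite /= !in_itv/= => /andP[-> /ltW].
    by rewrite (hP s (w _ s01)).2 (hP t (w _ t01)).2 hst.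
- by move=> _ [t /hP[? _] <-].
Qed.

Lemma attractor_no_closed_curve (R : realType) (n m : nat)
    (v : 'I_n -> plane R) (S : 'I_m -> plane R -> plane R) (K : set (plane R)) :
  range v !=set0 -> contractible_polygonal_system v S -> is_attractor S K ->
  K `<=` hull (range v) -> ~ contains_simple_closed_curve R K.
Proof.
move=> v0 [simS SP SI _ contrP] [_ kK KE] KP [g [cg g01 ig gK]].
have [r r01 rS] := common_ratio simS; have /andP[r0 _] := r01.
have contS i : continuous (S i) := contracts_continuous r0 (rS i).
have kI i X : compact X -> compact (S i @` X).
  by apply: continuous_compact; exact: continuous_subspaceT.
have split := @contractible_split R m (fun i => S i @` hull (range v)).
(* The splitting is known for the polygons [S i @] hull (range v)[and passes to the smaller sets]S i
   @[K]. *)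
have {}split (U : {set 'I_m}) : (1 < #|U|)%N ->
    exists (U1 U2 : {set 'I_m}) (p : plane R),
      [/\ U1 \proper U, U2 \proper U, U = U1 :|: U2 &
        forall a b x, a \in U1 -> b \in U2 -> (S a @` K) x -> (S b @` K) x -> x = p].
  move=> U1; have [| | |//|//|V [W [p [VU WU UVW H]]]] := split _ _ _ _ U.
  - by move=> i; apply: kI; exact: compact_hull.
  - move=> i; apply: connected_continuous_connected; first exact: connected_hull.
    exact: continuous_subspaceT.
  - move=> i j ij; have [->|[x [-> _ _]]] := SI i j ij; last by exists x.
    by exists 0.
  - exists V, W, p; split=> // a b x aV bW [y Ky <-] Sby.
    apply: H aV bW _ _; first by exists y => //; exact: KP.
    by case: Sby => z Kz <-; exists z => //; exact: KP.
have [D D0 KD] := compact_edist_bounded kK.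
(* Stated for all curves in [K] at once, because the induction step passes to the rescaled curve. *)
have bound N : forall g : R -> plane R, simple_closed_curve g -> g @` `[0, 1] `<=` K ->
    forall s t, `[0, 1]%classic s -> `[0, 1]%classic t ->
    edist (g s) (g t) <= r ^+ N * D.
  elim: N => [|N IH] g' scc g'K s t s01 t01.
    by rewrite expr0 mul1r; apply/ltW/KD; apply: g'K; [exists s|exists t].
  have [||i gi] := simple_closed_curve_in_piece scc _ split.
  - move=> i; apply: compact_closed; first exact: norm_hausdorff.
    exact: kI.
  - by rewrite -KE.
  have [h [scch hK gh]] := curve_unscale (simS i) scc gi.
  rewrite !gh//; apply: le_trans (rS i _ _) _; rewrite exprS -mulrA.
  by apply: ler_wpM2l; [exact: ltW|exact: IH].
have g0h : g 0 <> g 2^-1.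
  by move=> /ig; rewrite !in_itv/= => H; have := H _ _; lra.
have [N] := expr_lt_eps D r01 (edist_gt0 g0h).
apply/negP; rewrite -leNgt; apply: bound => //.
  by rewrite /= in_itv/= lexx ler01.
by rewrite /= in_itv/=; lra.
Qed.

(** * Connectedness and local connectedness of attractors *)

(* A set saturated at scale r ^+ N.+1 * D pulls back under each F i to one
   saturated at scale r ^+ N * D. *)
Lemma chain_saturated (R : realType) (k : nat) (F : 'I_k -> plane R -> plane R)
    (X : set (plane R)) (z : nat -> plane R) (r D : R) :
  0 < r -> (forall i, contracts r (F i)) ->
  X = \bigcup_i (F i @` X) ->
  (forall i : 'I_k, (F i @` X) (z i) /\ (F i @` X) (z i.+1)) ->
  (forall x y, X x -> X y -> edist x y < D) ->
  forall N (U : set (plane R)), U !=set0 -> U `<=` X ->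
    (forall x y, U x -> X y -> edist x y < r ^+ N * D -> U y) -> X `<=` U.
Proof.
move=> r0 rF XE zX XD.
have FX i x : X x -> X (F i x) by move=> Xx; rewrite XE; exists i => //; exists x.
elim=> [U [u Uu] UX sat x Xx|N IH U [u Uu] UX sat].
  by apply: (sat u) => //; rewrite expr0 mul1r; apply: XD => //; exact: UX.
(* A piece that meets [U] lies in [U]: the induction hypothesis applies to the preimage of [U] under
   [F i]. *)
have full i y : (F i @` X) y -> U y -> F i @` X `<=` U.
  move=> [x Xx <-] UFx _ [x' Xx' <-].
  have := IH [set x | X x /\ U (F i x)]; move=> /(_ _ _ _ _ Xx')[] //.
  - by exists x.
  - by move=> ? [].
  - move=> a b [Xa Ua] Xb ab; split=> //; apply: (sat (F i a)) => //; first exact: FX.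
    apply: le_lt_trans (rF i a b) _.
    by rewrite exprS -mulrA ltr_pM2l.
have [i0 _ i0u] : (\bigcup_i (F i @` X)) u by rewrite -XE; exact: UX.
(* Consecutive points [z i] and [z i.+1] lie in a common piece, so [U] contains all of them or
   none. *)
have Uz i : (i <= k)%N -> U (z i) <-> U (z 0%N).
  elim: i => [//|i IHi] ik; rewrite -IHi ?(ltnW ik)//.
  have [zi zi1] := zX (Ordinal ik).
  by split=> [/(full _ _ zi1)/(_ _ zi)|/(full _ _ zi)/(_ _ zi1)].
have Uz0 : U (z 0%N).
  by apply/(Uz i0); [exact: ltnW|exact: full i0u Uu _ (zX i0).1].
rewrite [X in X `<=` _]XE => x [i _ ix].
apply: (full i (z i)) => //; first exact: (zX i).1.
by apply/Uz => //; exact: ltnW.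
Qed.

Lemma compact_thickening (R : realType) (B O : set (plane R)) :
  compact B -> open O -> B `<=` O ->
  exists2 e, 0 < e & forall x y, B x -> edist x y < e -> O y.
Proof.
move=> kB oO BO.
pose P e x := forall y : plane R, `|x - y| < e -> O y.
have nP : \forall e \near (0 : R)^'+, B `<=` P e.
  move/compact_near_coveringP : kB => kB.
  apply: (kB R (0 : R)^'+ P) => x Bx.
  have /nbhs_ballP[d d0 dO] : nbhs x O by apply: open_nbhs_nbhs; split=> //; exact: BO.
  have d2 : 0 < d / 2 by rewrite divr_gt0.
  exists (ball x (d / 2), [set e | e < d / 2]).
    by split=> /=; [exact: nbhsx_ballx|exact: nbhs_right_lt].
  move=> [x' e] /=; rewrite -ball_normE /= => -[xx' ed] y x'y; apply: dO.
  rewrite -ball_normE /= -(subrKA x'); apply: le_lt_trans (ler_normD _ _) _.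
  by rewrite [ltRHS]splitr ltrD// (lt_trans x'y).
have [e [e0 eP]] : exists e : R, 0 < e /\ B `<=` P e.
  apply: (@filter_ex _ (0 : R)^'+); apply: filterI nP; exact: nbhs_right_gt.
exists e => // x y Bx xy; apply: (eP x Bx); exact: le_lt_trans (norm_le_edist x y) xy.
Qed.

(** A nonempty relatively clopen [B] is compact, so some positive distance separates it from the
    rest of [X]. It is thus saturated at a small scale and [chain_saturated] makes it all of [X]. *)
Lemma attractor_chain_connected (R : realType) (k : nat)
    (F : 'I_k -> plane R -> plane R) (X : set (plane R)) (z : nat -> plane R) :
  (forall i, contracting_similarity (F i)) -> compact X ->
  X = \bigcup_i (F i @` X) ->
  (forall i : 'I_k, (F i @` X) (z i) /\ (F i @` X) (z i.+1)) ->
  connected X.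
Proof.
move=> simF kX XE zX B B0 [V oV BV] [C cC BC].
have [r r01 rF] := common_ratio simF; have /andP[r0 _] := r01.
have BX : B `<=` X by rewrite BV; exact: subIsetl.
have kB : compact B by rewrite BC; apply: compact_closedI.
have BsubV : B `<=` V by rewrite BV; exact: subIsetr.
have [D D0 XD] := compact_edist_bounded kX.
have [e e0 eB] := compact_thickening kB oV BsubV.
have [N Ne] := expr_lt_eps D r01 e0.
apply/seteqP; split=> //.
apply: (chain_saturated r0 rF XE zX XD (N := N)) => // x y Bx Xy xy.
by rewrite BV; split=> //; apply: (eB x) => //; exact: lt_trans xy Ne.
Qed.

(** The pieces are the images of [X] under all [N]-fold compositions of the maps. *)
Lemma attractor_small_pieces (R : realType) (k : nat)
    (F : 'I_k -> plane R -> plane R) (X : set (plane R)) (r D : R) (N : nat) :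
  0 < r -> (forall i, contracts r (F i)) ->
  compact X -> connected X -> X = \bigcup_i (F i @` X) ->
  (forall x y, X x -> X y -> edist x y < D) ->
  exists (I : finType) (Q : I -> set (plane R)),
    [/\ forall i, compact (Q i), forall i, connected (Q i),
        forall i x y, Q i x -> Q i y -> edist x y <= r ^+ N * D
      & X = \bigcup_i Q i].
Proof.
move=> r0 rF kX cX XE XD; have contF i := contracts_continuous r0 (rF i).
elim: N => [|N [I [Q [kQ cQ dQ QX]]]].
  exists unit, (fun=> X); split=> // [_ x y Xx Xy|].
    by rewrite expr0 mul1r; apply/ltW/XD.
  by rewrite bigcup_const//; exists tt.
exists ('I_k * I)%type, (fun p => F p.1 @` Q p.2); split.
- move=> i; apply: continuous_compact => //; exact: continuous_subspaceT.
- move=> i; apply: connected_continuous_connected => //; exact: continuous_subspaceT.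
- move=> i _ _ [x Qx <-] [y Qy <-]; apply: le_trans (rF _ _ _) _.
  by rewrite exprS -mulrA; apply: ler_wpM2l; [exact: ltW|exact: dQ Qx Qy].
- apply/seteqP; split=> [x|x [[i j] _ [y Qy <-]]].
    rewrite {1}XE => -[i _ [y + <-]]; rewrite {1}QX => -[j _ Qy].
    by exists (i, j) => //; exists y.
  by rewrite XE; exists i => //; exists y => //; rewrite QX; exists j.
Qed.

(** The component of [x] in [U] is relatively open in [X]: small connected pieces through one of its
    points [y] stay in [U], hence in the component, and near [y] they cover [X]. *)
Lemma attractor_locally_connected (R : realType) (k : nat)
    (F : 'I_k -> plane R -> plane R) (X : set (plane R)) :
  (forall i, contracting_similarity (F i)) -> compact X -> connected X ->
  X = \bigcup_i (F i @` X) -> locally_connected X.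
Proof.
move=> simF kX cX XE x U Xx oU Ux.
have [r r01 rF] := common_ratio simF; have /andP[r0 _] := r01.
have [D D0 XD] := compact_edist_bounded kX.
pose C := connected_component (U `&` X) x.
have Cx : C x by apply: connected_component_refl.
have CUX : C `<=` U `&` X by exact: connected_component_sub.
have nC y : C y -> nbhs y (C `|` ~` X).
  move=> Cy; have [Uy Xy] := CUX _ Cy.
  have /nbhs_edistP[e e0 eU] : nbhs y U by apply: open_nbhs_nbhs.
  have [N Ne] := expr_lt_eps D r01 e0.
  have [I [Q [kQ cQ dQ QX]]] := attractor_small_pieces N r0 rF kX cX XE XD.
  have := @near_finite_closed _ I Q y.
  move=> /(_ (fun i => compact_closed (@norm_hausdorff _ _) (kQ i))).
  apply: filterS => w Qw; have [Xw|] := pselect (X w); last by right.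
  left; have [i _ Qiw] : (\bigcup_i Q i) w by rewrite -QX.
  have Qiy := Qw _ Qiw.
  rewrite /C (same_connected_component Cy).
  apply: (@connected_component_max _ _ (Q i)) => // u Qiu; split.
    by apply: eU; apply: le_lt_trans (dQ _ _ _ Qiy Qiu) Ne.
  by rewrite QX; exists i.
(* An open set of the plane whose trace on [X] is exactly [C]. *)
exists (interior (C `|` ~` X)).
have WX : interior (C `|` ~` X) `&` X = C.
  apply/seteqP; split=> [y [/interior_subset[//|nX] Xy]|y Cy]; first by [].
  by split; [exact: nC|exact: (CUX _ Cy).2].
rewrite WX; split.
- exact: open_interior.
- exact: nC.
- by move=> y /CUX[].
- exact: component_connected.
Qed.

(** * Polygonal lines and their attractors *)

(** With [z], [w] the images of the points of parameters [t], [u], and [f a], [f b] at parameters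
    [p], [q] of the image segment, comparing lengths gives [|p - q| * |t - u| = 1]. Both factors are
    at most 1, so [t] and [u] are 0 and 1 in some order. *)
Lemma similarity_segment_ends (R : realType) (f : plane R -> plane R)
    (a b z w : plane R) :
  contracting_similarity f -> a <> b -> f @` segment a b = segment z w ->
  (z = f a /\ w = f b) \/ (z = f b /\ w = f a).
Proof.
move=> [r [/andP[r0 _] fr]] /edist_gt0 ab fE.
have end0 (p q : plane R) : segment p q p.
  by exists 0; rewrite /= ?in_itv/= ?lexx ?ler01// subr0 scale1r scale0r addr0.
have end1 (p q : plane R) : segment p q q.
  by exists 1; rewrite /= ?in_itv/= ?lexx ?ler01// subrr scale1r scale0r add0r.
have [_ [t t01 <-] ft] : (f @` segment a b) z by rewrite fE.
have [_ [u u01 <-] fu] : (f @` segment a b) w by rewrite fE.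
have [p p01 fp] : segment z w (f a) by rewrite -fE; exists a.
have [q q01 fq] : segment z w (f b) by rewrite -fE; exists b.
have H : edist (f a) (f b) = r * edist a b := fr a b.
rewrite -fp -fq edist_segment -ft -fu fr edist_segment in H.
move: t01 u01 p01 q01; rewrite /= !in_itv/= => t01 u01 p01 q01.
have {}H : `|p - q| * `|t - u| = 1.
  apply: (@mulIf _ (r * edist a b)); first by rewrite mulf_neq0 ?gt_eqF.
  by rewrite mul1r -[RHS]H; ring.
have pq : `|p - q| <= 1 by rewrite ler_norml; lra.
have tu : `|t - u| = 1.
  apply/eqP; rewrite eq_le; apply/andP; split; first by rewrite ler_norml; lra.
  by rewrite -H ler_piMl.
rewrite -ft -fu; have [tu'|tu'] := lerP 0 (t - u).
  rewrite ger0_norm// in tu; right.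
  have -> : t = 1 by lra.
  have -> : u = 0 by lra.
  by rewrite subrr subr0 !scale1r !scale0r add0r addr0.
rewrite ltr0_norm// in tu; left.
have -> : t = 0 by lra.
have -> : u = 1 by lra.
by rewrite subrr subr0 !scale1r !scale0r add0r addr0.
Qed.

Lemma similarity_comp_isometry (R : realType) (f g : plane R -> plane R) :
  contracting_similarity f -> plane_isometry g -> contracting_similarity (f \o g).
Proof. by move=> [r [r01 fr]] gi; exists r; split=> // x y; rewrite /= fr gi. Qed.

Lemma polygonal_line_ends (R : realType) (k : nat)
    (F : 'I_k -> plane R -> plane R) (A B : plane R) :
  (forall i, contracting_similarity (F i)) -> A <> B -> polygonal_line A B F ->
  [set A; B] `<=` \bigcup_i (F i @` [set A; B]) /\
  exists (s : 'S_k) (z : nat -> plane R), forall i : 'I_k,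
    (F (s i) @` [set A; B]) (z i) /\ (F (s i) @` [set A; B]) (z i.+1).
Proof.
move=> simF AB [s [z [z0 zk zP]]].
have ends (i : 'I_k) :
    (F (s i) @` [set A; B]) (z i) /\ (F (s i) @` [set A; B]) (z i.+1).
  have iA : (F (s i) @` [set A; B]) (F (s i) A) by exists A => //; left.
  have iB : (F (s i) @` [set A; B]) (F (s i) B) by exists B => //; right.
  by have [[-> ->]|[-> ->]] := similarity_segment_ends (simF (s i)) AB (zP i).
split; last by exists s, z.
(* Without maps [z 0] would be both [A] and [B]; otherwise [A] is an end of the first segment and
   [B] of the last. *)
case: k F simF s zk zP ends => [|k] F simF s zk zP ends.
  by exfalso; apply: AB; rewrite -z0 -zk.
move=> _ [->|->]; [exists (s ord0) => //|exists (s ord_max) => //].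
  by have := (ends ord0).1; rewrite /= z0.
by have := (ends ord_max).2; rewrite /= zk.
Qed.

Theorem theorem6 (R : realType) (n m k : nat)
    (v : 'I_n -> plane R)
    (hv : convex_polygon_vertices v)
    (G : set (plane R -> plane R))
    (hG : nontrivial_symmetry_group (hull (range v)) G)
    (S : 'I_m -> plane R -> plane R)
    (hS : contractible_polygonal_system v S)
    (hGS : symmetric_system G S)
    (K : set (plane R)) (hK : is_attractor S K)
    (A B : plane R) (hA : range v A) (hB : range v B) (hAB : A <> B)
    (S' : 'I_k -> plane R -> plane R)
    (hS' : forall i, augmented_system G S (S' i))
    (hL : polygonal_line A B S')
    (KZ : set (plane R)) (hKZ : is_attractor S' KZ) :
  (continuum KZ /\ KZ `<=` K) /\
  ((exists (j : 'I_m) (i1 i2 : 'I_k),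
      let tL := \bigcup_i (S' i @` segment A B) in
      let Pj := S j @` hull (range v) in
      [/\ S' i1 @` segment A B <> S' i2 @` segment A B,
          S' i1 @` segment A B `<=` tL `&` Pj
        & S' i2 @` segment A B `<=` tL `&` Pj]) ->
   dendrite R KZ).
Proof.
have [simS SP _ _ _] := hS; have [K0 kK KE] := hK; have [KZ0 kKZ KZE] := hKZ.
have [GP _ Gcomp _ _] := hG.
have v0 : range v !=set0 by exists A.
set P := hull (range v) in SP GP *.
have kP : compact P := compact_hull v0.
have clP : closed P by apply: compact_closed => //; exact: norm_hausdorff.
have vP : range v `<=` P by exact: sub_gen_smallest.
(* One bound on the union of [KZ], [K] and [P] serves every use of [subinvariant_sub]. *)
have [D D0 bD] := compact_edist_bounded (compactU kKZ (compactU kK kP)).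
have simS' i : contracting_similarity (S' i).
  have [a [g [/GP[gi _] ->]]] := hS' i; exact: similarity_comp_isometry.
have S'P i : S' i @` P `<=` P.
  have [a [g [/GP[_ gP] ->]]] := hS' i; move=> _ [x Px <-].
  by apply: SP; exists (g x) => //; rewrite -[X in X _]gP; exists x.
have P0 : P !=set0 by exists A; exact: vP.
have KP : K `<=` P.
  apply: (subinvariant_sub (D := D) simS) => //; first by rewrite -KE.
  by move=> x y Kx Py; apply: bD; right; [left|right].
have KZP : KZ `<=` P.
  apply: (subinvariant_sub (D := D) simS') => //; first by rewrite -KZE.
  by move=> x y Kx Py; apply: bD; [left|right; right].
have KZK : KZ `<=` K.
  (* The maps of [S'] involve elements of [G], so the set compared with [K] is the orbit of [KZ]
     under [G]. It is covered by its images under [S], since [g \o S a \o h = S b \o (g' \o h)]. *)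
  suff : [set g x | g in G & x in KZ] `<=` K.
    by move=> GK x KZx; apply: GK; exists id; [case: hG|exists x].
  apply: (subinvariant_sub (D := D) simS) => //.
  - move=> _ [g Gg [x + <-]]; rewrite {1}KZE => -[i _ [y KZy <-]].
    have [a [h [Gh ->]]] := hS' i; have [g' [b [Gg' gS]]] := hGS g a Gg.
    exists b => //; exists (g' (h y)); last by have := congr1 (fun f => f (h y)) gS.
    by exists (g' \o h); [exact: Gcomp|exists y].
  - by move=> i x Kx; rewrite KE; exists i.
  - by apply: compact_closed => //; exact: norm_hausdorff.
  - move=> _ y [g Gg [x KZx <-]] Ky; apply: bD; right; [right|by left].
    by have [_ <-] := GP g Gg; exists x => //; exact: KZP.
have [ABL [s [z zAB]]] := polygonal_line_ends simS' hAB hL.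
(* Hence each piece of [KZ] contains both ends of its segment, and consecutive pieces meet. *)
have ABZ : [set A; B] `<=` KZ.
  apply: (subinvariant_sub (D := D) simS') => //.
  - by move=> i x Kx; rewrite KZE; exists i.
  - by apply: compact_closed => //; exact: norm_hausdorff.
  - by move=> x y ABx KZy; apply: bD; [right; right; apply: vP; case: ABx => ->|left].
have zX i : (S' (s i) @` KZ) (z i) /\ (S' (s i) @` KZ) (z i.+1).
  by have [zi zi1] := zAB i; split; exact: image_subset ABZ _ _.
(* Renumbering by [s] puts the maps in the order of the points [z i]. *)
have KZEs : KZ = \bigcup_i (S' (s i) @` KZ).
  rewrite {1}KZE; apply/seteqP; split=> x [i _ Six]; last by exists (s i).
  by exists (perm_inv s i) => //; rewrite permKV.
have cKZ : connected KZ by exact: (attractor_chain_connected _ kKZ KZEs zX).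
split=> [//|_]; split=> //.
  exact: (attractor_locally_connected simS').
have noK := attractor_no_closed_curve v0 hS hK KP.
move=> [g [cg g01 ig gKZ]]; apply: noK; exists g; split=> //.
exact: subset_trans gKZ KZK.
Qed.
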